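(* Let $\tilde g^1,\dots,\tilde g^m$ be real polynomials of degree at most two in $y\in\mathbb{R}^n$, let $\mathbf{Y}=\{y\in\mathbb{R}^n:\tilde g^i(y)=0,\ i=1,\dots,m\}$, and for $\theta\in\mathbb{R}^n$ consider the nearest point problem $$(E_\theta)\qquad\min_{y\in\mathbb{R}^n}\ \|y-\theta\|^2\quad\text{s.t.}\quad \tilde g^i(y)=0,\ i=1,\dots,m.$$ Let $\bar\theta\in\mathbf{Y}$ be such that $\mathrm{ACQ}_{\mathbf{Y}}(\bar\theta)$ holds. Then $(E_\theta)$ is SDP-stable near $\bar\theta$, and for $\theta$ near $\bar\theta$ the SDP relaxation recovers the minimizer of $(E_\theta)$.
   Context: For a quadratic polynomial $q(y)=y^\top Ay+2b^\top y+e$ ($A$ symmetric) let $M(q)=\begin{pmatrix}e&b^\top\\ b&A\end{pmatrix}\in\mathbb{S}^{n+1}$ be the matrix of its homogenization in the variables $x=(z_0,y)$, where $\mathbb{S}^{k}$ denotes real symmetric $k\times k$ matrices; write $E_{00}$ for the matrix with a single $1$ in the top left entry, and $\bullet$ for the trace inner product. The SDP relaxations of an inhomogeneous problem $\min\{\tilde f(y):\tilde g^i(y)=0,\ i=1,\dots,m\}$ are those of its homogenization (with constraint $z_0^2=1$), namely $$(P)\ \min_{S\in\mathbb{S}^{n+1}} M(\tilde f)\bullet S\ \text{ s.t. } M(\tilde g^i)\bullet S=0\ \forall i,\ E_{00}\bullet S=1,\ S\succeq0;$$ $$(D)\ \max_{\lambda_0\in\mathbb{R},\,\mu\in\mathbb{R}^m}-\lambda_0\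 \text{ s.t. } M(\tilde f)+\lambda_0E_{00}+\sum_i\mu_iM(\tilde g^i)\succeq0.$$ Here $\tilde f(y)=\|y-\theta\|^2$. A problem has zero duality gap if its optimal value equals the optimal values of $(P)$ and of $(D)$. The family is SDP-stable near $\bar\theta$ if there is a neighborhood of $\bar\theta$ on which all problems have zero duality gap. ''The SDP recovers the minimizer'' means that $(P)$ has a unique optimal solution and it equals $xx^\top$ with $x=(1,y)$ and $y$ the minimizer of the problem. Abadie constraint qualification: for the map $\tilde g=(\tilde g^1,\dots,\tilde g^m)$ with zero set $\mathbf{Y}$ and $y\in\mathbf{Y}$, $\mathrm{ACQ}_{\mathbf{Y}}(y)$ holds if $\mathbf{Y}$ is a smooth manifold near $y$ and $\mathrm{rank}\,\nabla\tilde g(y)=\mathrm{codim}_y\mathbf{Y}:=n-\dim_y\mathbf{Y}$, where $\nabla\tilde g$ is the Jacobian. *)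

(* Defs.v *)
(* Points of R^n are row vectors. *)
From mathcomp Require Import all_boot all_order all_algebra.
From mathcomp Require Import boolp classical_sets reals constructive_ereal.
From mathcomp Require Import ereal topology normedtype derive.
From mathcomp Require Import ring.

Set Implicit Arguments.
Unset Strict Implicit.
Unset Printing Implicit Defensive.

Import Order.TTheory GRing.Theory Num.Theory.
Import numFieldNormedType.Exports.

Local Open Scope classical_set_scope.
Local Open Scope ring_scope.

(* Since [quad_A] is symmetric, these records are in bijection with the real
   polynomials of degree at most two in n variables. *)
Record quad (R : realType) (n : nat) := Quad {
  quad_A : 'M[R]_n;
  quad_b : 'rV[R]_n;
  quad_e : R;
  quad_sym : quad_A^T = quad_A }.

Definition quad_eval (R : realType) (n : nat) (q : quad R n) (y : 'rV[R]_n) : R :=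
  (y *m quad_A q *m y^T) 0 0 + 2 * (quad_b q *m y^T) 0 0 + quad_e q.

Definition hom_mx (R : realType) (n : nat) (q : quad R n) : 'M[R]_(1 + n) :=
  block_mx (quad_e q)%:M (quad_b q) (quad_b q)^T (quad_A q).

(* Squared Euclidean norm; the library norm of 'rV[R]_n is the sup norm. *)
Definition sqnorm (R : realType) (n : nat) (v : 'rV[R]_n) : R :=
  \sum_(i < n) v 0 i ^+ 2.

Definition dist_quad (R : realType) (n : nat) (theta : 'rV[R]_n) : quad R n :=
  @Quad R n 1%:M (- theta) (sqnorm theta) (trmx1 R n).

Lemma dist_quadE (R : realType) (n : nat) (theta y : 'rV[R]_n) :
  quad_eval (dist_quad theta) y = sqnorm (y - theta).
Proof.
rewrite /quad_eval /sqnorm /= mulmx1 !mxE mulr_sumr -!big_split /=.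
by apply: eq_bigr => i _; rewrite !mxE; ring.
Qed.

Definition zero_set (R : realType) (n m : nat) (g : 'I_m -> quad R n) :
    set 'rV[R]_n :=
  [set y | forall i, quad_eval (g i) y = 0].

Definition constraint_map (R : realType) (n m : nat) (g : 'I_m -> quad R n)
    (y : 'rV[R]_n) : 'rV[R]_m :=
  \row_i quad_eval (g i) y.

(* Class C^k on an open set U, by induction on k through the directional
   derivatives; in finite dimension this is the usual notion. *)
Fixpoint Ck_on (R : realType) (V W : normedModType R) (k : nat) (U : set V)
    (f : V -> W) : Prop :=
  match k with
  | 0 => forall x, U x -> {for x, continuous f}
  | k'.+1 => (forall x, U x -> differentiable f x) /\
             (forall v, Ck_on k' U (fun x => 'D_v f x))
  end.

Definition smooth_on (R : realType) (V W : normedModType R) (U : set V)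
    (f : V -> W) : Prop :=
  forall k, Ck_on k U f.

(* Near y, Y is a smooth embedded submanifold of R^n of dimension d: some smooth
   diffeomorphism phi : U -> V between open sets, with y in U and inverse psi,
   straightens Y `&` U to the slice where the last n - d coordinates vanish. *)
Definition smooth_manifold_near (R : realType) (n : nat) (Y : set 'rV[R]_n)
    (y : 'rV[R]_n) (d : nat) : Prop :=
  (d <= n)%N /\
  exists (U V : set 'rV[R]_n) (phi psi : 'rV[R]_n -> 'rV[R]_n),
    [/\ [/\ open U, open V & U y],
        smooth_on U phi /\ smooth_on V psi,
        (forall x, U x -> V (phi x) /\ psi (phi x) = x),
        (forall z, V z -> U (psi z) /\ phi (psi z) = z)
      & forall x, U x -> (Y x <-> forall i : 'I_n, (d <= i)%N -> phi x 0 i = 0)].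

(* The library Jacobian is the transpose (n x m) of the usual one. *)
Definition ACQ (R : realType) (n m : nat) (g : 'I_m -> quad R n)
    (y : 'rV[R]_n) : Prop :=
  exists d : nat, smooth_manifold_near (zero_set g) y d /\
    \rank ('J (constraint_map g) y) = (n - d)%N.

Definition psd (R : realType) (k : nat) (S : 'M[R]_k) : Prop :=
  S^T = S /\ forall x : 'rV[R]_k, 0 <= (x *m S *m x^T) 0 0.

Definition mxdot (R : realType) (k : nat) (A B : 'M[R]_k) : R := \tr (A^T *m B).

Definition E00 (R : realType) (n : nat) : 'M[R]_(1 + n) := delta_mx 0 0.

Definition npp_minimizer (R : realType) (n m : nat) (g : 'I_m -> quad R n)
    (theta y : 'rV[R]_n) : Prop :=
  zero_set g y /\
  forall y', zero_set g y' -> sqnorm (y - theta) <= sqnorm (y' - theta).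

(* Optimal values live in the extended reals (+oo for an infeasible
   minimization, -oo for an infeasible maximization). *)
Definition npp_value (R : realType) (n m : nat) (g : 'I_m -> quad R n)
    (theta : 'rV[R]_n) : \bar R :=
  ereal_inf [set (sqnorm (y - theta))%:E | y in zero_set g].

Definition P_feasible (R : realType) (n m : nat) (g : 'I_m -> quad R n) :
    set 'M[R]_(1 + n) :=
  [set S | [/\ forall i, mxdot (hom_mx (g i)) S = 0,
               mxdot (E00 R n) S = 1 & psd S]].

Definition P_value (R : realType) (n m : nat) (f : quad R n)
    (g : 'I_m -> quad R n) : \bar R :=
  ereal_inf [set (mxdot (hom_mx f) S)%:E | S in P_feasible g].

Definition P_optimal (R : realType) (n m : nat) (f : quad R n)
    (g : 'I_m -> quad R n) (S : 'M[R]_(1 + n)) : Prop :=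
  P_feasible g S /\
  forall S', P_feasible g S' -> mxdot (hom_mx f) S <= mxdot (hom_mx f) S'.

Definition D_feasible (R : realType) (n m : nat) (f : quad R n)
    (g : 'I_m -> quad R n) : set (R * ('I_m -> R)) :=
  [set lm | psd (hom_mx f + lm.1 *: E00 R n
                 + \sum_(i < m) lm.2 i *: hom_mx (g i))].

Definition D_value (R : realType) (n m : nat) (f : quad R n)
    (g : 'I_m -> quad R n) : \bar R :=
  ereal_sup [set (- lm.1)%:E | lm in D_feasible f g].

Definition zero_duality_gap (R : realType) (n m : nat) (g : 'I_m -> quad R n)
    (theta : 'rV[R]_n) : Prop :=
  npp_value g theta = P_value (dist_quad theta) g /\
  npp_value g theta = D_value (dist_quad theta) g.

Definition SDP_stable_near (R : realType) (n m : nat) (g : 'I_m -> quad R n)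
    (thetabar : 'rV[R]_n) : Prop :=
  \forall theta \near thetabar, zero_duality_gap g theta.

Definition lift_mx (R : realType) (n : nat) (y : 'rV[R]_n) : 'M[R]_(1 + n) :=
  (row_mx 1%:M y)^T *m row_mx 1%:M y.

Lemma mxdot_hom_lift (R : realType) (n : nat) (q : quad R n) (y : 'rV[R]_n) :
  mxdot (hom_mx q) (lift_mx y) = quad_eval q y.
Proof.
rewrite /mxdot /lift_mx mulmxA mxtrace_mulC /hom_mx tr_block_mx quad_sym trmxK.
rewrite tr_scalar_mx tr_row_mx trmx1 mul_block_col mul_row_col !mulmx1 !mul1mx.
rewrite mulmxDr mulmxA /mxtrace big_ord1 /quad_eval.
have -> : y *m (quad_b q)^T = quad_b q *m y^T.
  apply/matrixP => i j; rewrite !ord1 !mxE.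
  by apply: eq_bigr => k _; rewrite !mxE mulrC.
rewrite mxE [X in X + _]mxE [X in _ + X]mxE.
have -> : ((quad_e q)%:M : 'M[R]_1) ord0 ord0 = quad_e q.
  by rewrite mxE mulr1n.
by ring.
Qed.

Definition SDP_recovers (R : realType) (n m : nat) (g : 'I_m -> quad R n)
    (theta : 'rV[R]_n) : Prop :=
  exists y, unique (npp_minimizer g theta) y /\
    unique (P_optimal (dist_quad theta) g) (lift_mx y).

(* Main.v *)
Require Import Defs.
From mathcomp Require Import all_boot all_order all_algebra.
From mathcomp Require Import boolp classical_sets functions reals.
From mathcomp Require Import constructive_ereal.
From mathcomp Require Import ereal topology normedtype derive.
From mathcomp Require Import ring lra.

Set Implicit Arguments.
Unset Strict Implicit.
Unset Printing Implicit Defensive.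

Import Order.TTheory GRing.Theory Num.Theory.
Import numFieldNormedType.Exports.
Local Open Scope classical_set_scope.
Local Open Scope ring_scope.

(** The relaxation is exact at theta as soon as some feasible y and some small
multipliers mu make y a critical point of the Lagrangian
|y - theta|^2 + sum_i mu_i g_i(y).  Indeed this Lagrangian is a quadratic
polynomial whose Hessian is (twice) 1 + sum_i mu_i A_i, a small perturbation
of the identity, so it is strictly convex and y is its unique global minimizer.
Homogenizing, its matrix is |y - theta|^2 E00 + Z^T (1 + sum_i mu_i A_i) Z,
where Z maps (s, v) to v - s y: the multipliers are therefore dual feasible
with the value |y - theta|^2, and the objective of (P) exceeds this value on a
feasible S by at least half the trace of Z S Z^T.  When this excess vanishes so
does Z S, which forces S = x x^T with x = (1, y).  This is the content of
[critical_zero_duality_gap] and [critical_SDP_recovers].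

It remains to find such a pair for theta near thetabar
([critical_pair_near]).  A nearest point y to theta exists by compactness, and
lies within a constant times |theta - thetabar| of thetabar.  In a chart of Y
the derivatives at y of the distance function and of every constraint vanish
along the d-dimensional tangent space, so y - theta and the rows of the
Jacobian are all normal vectors ([chart_tangent]).  By the constraint
qualification the Jacobian has rank n - d at thetabar, hence at least n - d
nearby, so its rows span the normal space at y, and y - theta is a combination
of them.  Choosing fixed matrices K and L such that K G L = 1 for the
half-gradient matrix G at thetabar selects n - d combinations of the rows that
stay uniformly independent near thetabar; the coefficients are then bounded by a
constant times |y - theta| ([multiplier_bound]), hence tend to 0 as theta tends
to thetabar. *)

(** * Positive semidefinite matrices *)

Section Psd.
Context {R : realType}.

Lemma mx11_tr (M : 'M[R]_1) : M 0 0 = \tr M.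
Proof. by rewrite /mxtrace big_ord1. Qed.

Lemma mxdotDl k (A B S : 'M[R]_k) : mxdot (A + B) S = mxdot A S + mxdot B S.
Proof. by rewrite /mxdot linearD mulmxDl mxtraceD. Qed.

Lemma mxdotZl k a (A S : 'M[R]_k) : mxdot (a *: A) S = a * mxdot A S.
Proof. by rewrite /mxdot linearZ -scalemxAl mxtraceZ. Qed.

Lemma mxdot_suml k (I : finType) (A : I -> 'M[R]_k) S :
  mxdot (\sum_i A i) S = \sum_i mxdot (A i) S.
Proof. by rewrite /mxdot linear_sum mulmx_suml linear_sum. Qed.

Lemma mxdot_sqr k (M : 'M[R]_k) (x : 'rV[R]_k) :
  mxdot M (x^T *m x) = (x *m M *m x^T) 0 0.
Proof.
by rewrite mx11_tr -mxtrace_tr !trmx_mul trmxK /mxdot mulmxA mxtrace_mulC.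
Qed.

Lemma mxdot_congr k p (Z : 'M[R]_(p, k)) (H : 'M[R]_p) (S : 'M[R]_k) :
  mxdot (Z^T *m H *m Z) S = mxdot H (Z *m S *m Z^T).
Proof.
rewrite /mxdot !trmx_mul trmxK -!mulmxA mxtrace_mulC.
by rewrite !mulmxA.
Qed.

Lemma psd_congr k p (Z : 'M[R]_(p, k)) (S : 'M[R]_k) :
  psd S -> psd (Z *m S *m Z^T).
Proof.
move=> [symS S_ge0]; split=> [|x]; first by rewrite !trmx_mul trmxK symS mulmxA.
by have := S_ge0 (x *m Z); rewrite trmx_mul !mulmxA.
Qed.

Lemma psd_sqr k (x : 'rV[R]_k) : psd (x^T *m x).
Proof.
split=> [|v]; first by rewrite trmx_mul trmxK.
rewrite mulmxA -mulmxA.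
have -> : x *m v^T = (v *m x^T)^T by rewrite trmx_mul trmxK.
by rewrite mxE big_ord1 [X in _ * X]mxE -expr2 sqr_ge0.
Qed.

Lemma sym_form k (S : 'M[R]_k) (u v : 'rV[R]_k) : S^T = S ->
  (u *m S *m v^T) 0 0 = (v *m S *m u^T) 0 0.
Proof.
by move=> symS; rewrite !mx11_tr -mxtrace_tr !trmx_mul trmxK symS mulmxA.
Qed.

Lemma form_line k (S : 'M[R]_k) (u v : 'rV[R]_k) t : S^T = S ->
  ((u + t *: v) *m S *m (u + t *: v)^T) 0 0 =
  (u *m S *m u^T) 0 0 + 2 * t * (u *m S *m v^T) 0 0
  + t ^+ 2 * (v *m S *m v^T) 0 0.
Proof.
move=> symS.
rewrite linearD linearZ /= !mulmxDl !mulmxDr -!scalemxAl -!scalemxAr.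
rewrite [LHS]mxE [X in X + _]mxE [X in _ + X]mxE.
rewrite [X in _ + X + _]mxE [X in _ + (X + _)]mxE [X in _ + (_ + X)]mxE.
rewrite [X in _ + (_ + _ * X)]mxE (sym_form v u symS).
by ring.
Qed.

Lemma form_delta k (S : 'M[R]_k) i j :
  ((delta_mx 0 i : 'rV_k) *m S *m (delta_mx 0 j : 'rV_k)^T) 0 0 = S i j.
Proof. by rewrite trmx_delta -rowE -colE !mxE. Qed.

Lemma psd_diag_ge0 k (S : 'M[R]_k) i : psd S -> 0 <= S i i.
Proof. by move=> [_ /(_ (delta_mx 0 i))]; rewrite form_delta. Qed.

(** Positivity of S on the two vectors e_i + e_j and e_i - e_j. *)
Lemma psd_entry_le k (S : 'M[R]_k) i j : psd S ->
  `|S i j| <= (S i i + S j j) / 2.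
Proof.
move=> [symS S_ge0].
have Sij t := S_ge0 (delta_mx 0 i + t *: delta_mx 0 j).
have := Sij 1; have := Sij (-1); rewrite !form_line // !form_delta.
by rewrite ler_norml => *; lra.
Qed.

(** The quadratic t |-> (u + t e_j) S (u + t e_j)^T is nonnegative and vanishes
at 0, so its linear coefficient vanishes. *)
Lemma psd_ker k (S : 'M[R]_k) (u : 'rV[R]_k) : psd S ->
  (u *m S *m u^T) 0 0 = 0 -> u *m S = 0.
Proof.
move=> [symS S_ge0] uSu; apply/rowP => j; rewrite [RHS]mxE.
have Sj t : 0 <= 2 * t * (u *m S) 0 j + t ^+ 2 * S j j.
  have := S_ge0 (u + t *: delta_mx 0 j).
  rewrite form_line // uSu add0r form_delta trmx_delta -colE.
  by rewrite [X in _ * X + _]mxE.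
have Sjj : 0 <= S j j by apply: psd_diag_ge0.
set a : R := (u *m S) 0 j in Sj *; set b : R := S j j in Sj Sjj.
have b1_neq0 : b + 1 != 0 by rewrite lt0r_neq0 // ltr_wpDl.
(* The quadratic 2 a t + b t^2 would be minimal at - a / b, but b may be 0. *)
have := Sj (- a / (b + 1)).
have -> : 2 * (- a / (b + 1)) * a + (- a / (b + 1)) ^+ 2 * b =
          - (a ^+ 2) * ((b + 2) / (b + 1) ^+ 2) by field.
rewrite mulNr oppr_ge0 pmulr_lle0; last by rewrite divr_gt0 ?exprn_gt0 //; lra.
by move=> a2; apply/eqP; rewrite -sqrf_eq0 eq_le a2 sqr_ge0.
Qed.

(** Comparing the entries of W to its diagonal replaces, for H close to the
identity, the positivity of the trace product of two psd matrices; it needs no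
spectral theorem and yields a definite fraction of the trace. *)
Lemma mxdot_near1_ge k (H W : 'M[R]_k) (e : R) :
  (forall i j, `|(H - 1%:M) i j| <= e) -> psd W ->
  (1 - e * k%:R) * \tr W <= mxdot H W.
Proof.
move=> He psdW; rewrite -[H in leRHS](subrKC 1%:M) mxdotDl.
rewrite {1}/mxdot trmx1 mul1mx mulrBl mul1r lerD2l.
set N := H - 1%:M in He *.
have -> : mxdot N W = \sum_i \sum_j N i j * W i j.
  rewrite exchange_big; apply: eq_bigr => j _; rewrite mxE.
  by apply: eq_bigr => i _; rewrite mxE.
have -> : - (e * k%:R * \tr W) = \sum_i \sum_j - (e * ((W i i + W j j) / 2)).
  transitivity (- (e * (2^-1 * \sum_i \sum_j (W i i + W j j)))); last first.
    rewrite !mulr_sumr -sumrN; apply: eq_bigr => i _.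
    by rewrite !mulr_sumr -sumrN; apply: eq_bigr => j _; ring.
  under eq_bigr do rewrite big_split /= sumr_const card_ord.
  rewrite big_split /= sumrMnl sumr_const card_ord -/(mxtrace W).
  by rewrite -mulr_natl; field.
apply: ler_sum => i _; apply: ler_sum => j _.
have := ler_pM (normr_ge0 _) (normr_ge0 _) (He i j) (psd_entry_le i j psdW).
by rewrite -normrM; apply: lerNnormlW.
Qed.

Lemma psd_trace_ge0 k (W : 'M[R]_k) : psd W -> 0 <= \tr W.
Proof. by move=> psdW; apply: sumr_ge0 => i _; apply: psd_diag_ge0. Qed.

Lemma psd_congr_trace0 k p (Z : 'M[R]_(p, k)) (S : 'M[R]_k) : psd S ->
  \tr (Z *m S *m Z^T) <= 0 -> Z *m S = 0.
Proof.
move=> psdS trW; have psdW := psd_congr Z psdS.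
apply/row_matrixP => i; rewrite row_mul row0; apply: psd_ker => //.
have -> : (row i Z *m S *m (row i Z)^T) 0 0 = (Z *m S *m Z^T) i i.
  by rewrite -row_mul tr_row !mxE; apply: eq_bigr => j _; rewrite !mxE.
apply/eqP; rewrite eq_le psd_diag_ge0 // andbT; apply: le_trans trW.
rewrite /mxtrace (bigD1 i) //= lerDl.
by apply: sumr_ge0 => j _; apply: psd_diag_ge0.
Qed.

End Psd.

(** * Critical points of the Lagrangian certify exactness *)

Section Certificate.
Context {R : realType} {n : nat}.
Implicit Types (q : quad R n) (y theta : 'rV[R]_n).

(** Half of the gradient, so that no factor 2 enters the homogenization. *)
Definition quad_grad q y : 'rV[R]_n := y *m quad_A q + quad_b q.

Lemma quad_grad_dist theta y : quad_grad (dist_quad theta) y = y - theta.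
Proof. by rewrite /quad_grad mulmx1. Qed.

Lemma quad_evalD q y h :
  quad_eval q (y + h) =
  quad_eval q y + 2 * (quad_grad q y *m h^T) 0 0 + (h *m quad_A q *m h^T) 0 0.
Proof.
rewrite /quad_eval /quad_grad -[h in LHS]scale1r form_line ?quad_sym //.
rewrite scale1r linearD !mulmxDr !mulmxDl.
rewrite ![(_ + _ : 'M_(_, _)) 0 0]mxE.
by ring.
Qed.

Lemma lagrangian_sym (I : finType) (f : quad R n) (g : I -> quad R n)
    (mu : I -> R) :
  (quad_A f + \sum_i mu i *: quad_A (g i))^T =
  quad_A f + \sum_i mu i *: quad_A (g i).
Proof.
rewrite linearD linear_sum /= quad_sym; congr (_ + _).
by apply: eq_bigr => i _; rewrite linearZ /= quad_sym.
Qed.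

Definition lagrangian (I : finType) (f : quad R n) (g : I -> quad R n)
    (mu : I -> R) : quad R n :=
  Quad (quad_b f + \sum_i mu i *: quad_b (g i))
       (quad_e f + \sum_i mu i * quad_e (g i)) (lagrangian_sym f g mu).

Lemma hom_mx_lagrangian (I : finType) (f : quad R n) (g : I -> quad R n)
    (mu : I -> R) :
  hom_mx (lagrangian f g mu) = hom_mx f + \sum_i mu i *: hom_mx (g i).
Proof.
rewrite /hom_mx; apply/matrixP => i j; rewrite [RHS]mxE summxE.
rewrite -[i]splitK -[j]splitK.
case: (fintype.split i) => i' /=; case: (fintype.split j) => j' /=;
  rewrite ?(block_mxEul, block_mxEur, block_mxEdl, block_mxEdr) !mxE ?summxE.
- rewrite mulrnDl -sumrMnl; congr (_ + _); apply: eq_bigr => k _.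
  by rewrite mxE block_mxEul mxE mulrnAr.
- by congr (_ + _); apply: eq_bigr => k _; rewrite mxE [RHS]mxE block_mxEur.
- by congr (_ + _); apply: eq_bigr => k _; rewrite mxE [RHS]mxE block_mxEdl mxE.
- by congr (_ + _); apply: eq_bigr => k _; rewrite mxE [RHS]mxE block_mxEdr.
Qed.

Lemma quad_eval_lagrangian (I : finType) (f : quad R n) (g : I -> quad R n)
    (mu : I -> R) y :
  quad_eval (lagrangian f g mu) y =
  quad_eval f y + \sum_i mu i * quad_eval (g i) y.
Proof.
rewrite -!mxdot_hom_lift hom_mx_lagrangian mxdotDl mxdot_suml; congr (_ + _).
by apply: eq_bigr => i _; rewrite mxdotZl mxdot_hom_lift.
Qed.

Lemma quad_grad_lagrangian (I : finType) (f : quad R n) (g : I -> quad R n)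
    (mu : I -> R) y :
  quad_grad (lagrangian f g mu) y =
  quad_grad f y + \sum_i mu i *: quad_grad (g i) y.
Proof.
rewrite /quad_grad /= mulmxDr mulmx_sumr addrACA -big_split /=; congr (_ + _).
by apply: eq_bigr => i _; rewrite -scalemxAr scalerDr.
Qed.

Lemma E00_block : E00 R n = block_mx 1%:M 0 0 0.
Proof.
apply/matrixP => i j; rewrite -[i]splitK -[j]splitK /E00 mxE.
case: (fintype.split i) => i' /=; case: (fintype.split j) => j' /=;
  rewrite ?(block_mxEul, block_mxEur, block_mxEdl, block_mxEdr) mxE;
  by rewrite -?val_eqE /= ?ord1.
Qed.

(** The matrix of (s, v) |-> v - s y, whose kernel is the line of (1, y). *)
Definition centering_mx y : 'M[R]_(n, 1 + n) := row_mx (- y^T) 1%:M.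

(** Expanding q around a critical point y leaves only the value q(y) and the
quadratic part in v - s y. *)
Lemma hom_mx_critical q y : quad_grad q y = 0 ->
  hom_mx q = quad_eval q y *: E00 R n
           + (centering_mx y)^T *m quad_A q *m centering_mx y.
Proof.
move=> grad0.
have b_eq : quad_b q = - (y *m quad_A q).
  by apply/eqP; rewrite -addr_eq0 addrC -/(quad_grad q y) grad0.
have bT_eq : (quad_b q)^T = - (quad_A q *m y^T).
  by rewrite b_eq linearN /= trmx_mul quad_sym.
have ZT_eq : (centering_mx y)^T = col_mx (- y) 1%:M.
  by rewrite tr_row_mx trmx1 linearN /= trmxK.
rewrite E00_block scale_block_mx !scaler0 ZT_eq /centering_mx mul_col_mx.
rewrite mul_col_row add_block_mx !add0r !mul1mx !mulmx1.
rewrite !mulNmx !mulmxN opprK -b_eq -bT_eq /hom_mx; congr block_mx.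
apply/matrixP => i j; rewrite !ord1 [RHS]mxE [X in _ = X + _]mxE.
rewrite [LHS]mxE [1%:M _ _]mxE /= !mulr1n mulr1 /quad_eval b_eq mulNmx.
by rewrite [(- _ : 'M_1) _ _]mxE; ring.
Qed.

Lemma mxdot_E00 (S : 'M[R]_(1 + n)) : mxdot (E00 R n) S = S 0 0.
Proof.
rewrite /mxdot /E00 trmx_delta -(mul_delta_mx (0 : 'I_1)) -mulmxA mxtrace_mulC.
by rewrite -mx11_tr -rowE -colE !mxE.
Qed.

Lemma centering_mx_lift_uniq y (S : 'M[R]_(1 + n)) :
  S^T = S -> mxdot (E00 R n) S = 1 -> centering_mx y *m S = 0 -> S = lift_mx y.
Proof.
move=> symS E00S.
have Sul : ulsubmx S = 1%:M.
  apply/matrixP => i j; rewrite !ord1 !mxE -E00S mxdot_E00 mulr1n.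
  by congr (S _ _); apply: val_inj.
have Sdl : dlsubmx S = (ursubmx S)^T by rewrite trmx_ursub symS.
rewrite -[S]submxK Sul Sdl /centering_mx mul_row_block !mulmx1 !mul1mx.
rewrite -[0]hsubmxK => /eq_row_mx[/eqP + /eqP].
rewrite !linear0 addrC subr_eq0 mulNmx addrC subr_eq0 => /eqP Sur /eqP ->.
have -> : ursubmx S = y by rewrite -[LHS]trmxK Sur trmxK.
by rewrite /lift_mx tr_row_mx trmx1 mul_col_row !mul1mx mulmx1.
Qed.


Lemma lift_mx_inj : injective (@lift_mx R n).
Proof.
move=> y y'; rewrite /lift_mx tr_row_mx trmx1 !tr_row_mx trmx1 !mul_col_row.
by rewrite !mul1mx => /eq_block_mx[_ ].
Qed.

Lemma mxdot_lift_E00 y : mxdot (E00 R n) (lift_mx y) = 1.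
Proof.
rewrite mxdot_E00 /lift_mx mxE big_ord1 !mxE.
by case: splitP => [j _|//]; rewrite mxE [j]ord1 mulr1.
Qed.

Section GlobalCertificate.
Context {m : nat} (g : 'I_m -> quad R n) (theta y : 'rV[R]_n) (mu : 'I_m -> R).
Context (y_feasible : zero_set g y).
Context (y_critical : y - theta + \sum_i mu i *: quad_grad (g i) y = 0).
(* The bound on e makes 1 + sum_i mu_i A_i at least 1/2 in the sense of
   mxdot_near1_ge. *)
Context (mu_small : exists2 e : R, e * n%:R <= 2^-1 &
  forall j k, `|(\sum_i mu i *: quad_A (g i)) j k| <= e).

Let f := dist_quad theta.
Let L := lagrangian f g mu.

Lemma hom_mx_lagrangian_critical :
  hom_mx L = quad_eval f y *: E00 R n
           + (centering_mx y)^T *m quad_A L *m centering_mx y.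
Proof.
rewrite (@hom_mx_critical L y); last first.
  by rewrite quad_grad_lagrangian quad_grad_dist.
rewrite quad_eval_lagrangian big1 ?addr0 // => i _.
by rewrite y_feasible mulr0.
Qed.

Lemma mxdot_remainder_ge (S : 'M[R]_(1 + n)) : psd S ->
  2^-1 * \tr (centering_mx y *m S *m (centering_mx y)^T) <=
  mxdot ((centering_mx y)^T *m quad_A L *m centering_mx y) S.
Proof.
move=> psdS; have psdW := psd_congr (centering_mx y) psdS.
have [e en He] := mu_small; rewrite mxdot_congr.
apply: le_trans (mxdot_near1_ge (e := e) _ psdW).
  by apply: ler_wpM2r; [apply: psd_trace_ge0 | lra].
by move=> i j; rewrite /= addrC addKr.
Qed.

Lemma P_objective_ge (S : 'M[R]_(1 + n)) : P_feasible g S ->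
  quad_eval f y + 2^-1 * \tr (centering_mx y *m S *m (centering_mx y)^T) <=
  mxdot (hom_mx f) S.
Proof.
move=> [gS E00S psdS].
have -> : mxdot (hom_mx f) S = mxdot (hom_mx L) S.
  rewrite hom_mx_lagrangian mxdotDl mxdot_suml big1 ?addr0 // => i _.
  by rewrite mxdotZl gS mulr0.
rewrite hom_mx_lagrangian_critical mxdotDl mxdotZl E00S mulr1 lerD2l.
exact: mxdot_remainder_ge.
Qed.

Lemma P_objective_ge_opt (S : 'M[R]_(1 + n)) : P_feasible g S ->
  quad_eval f y <= mxdot (hom_mx f) S.
Proof.
move=> feasS; apply: le_trans (P_objective_ge feasS); rewrite lerDl.
by apply: mulr_ge0 => //; apply/psd_trace_ge0/psd_congr; case: feasS.
Qed.

Lemma P_feasible_lift z : zero_set g z -> P_feasible g (lift_mx z).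
Proof.
move=> gz; split; last exact: psd_sqr; last exact: mxdot_lift_E00.
by move=> i; rewrite mxdot_hom_lift.
Qed.

Lemma critical_minimizer : npp_minimizer g theta y.
Proof.
split=> // z gz; rewrite -!dist_quadE -[leRHS]mxdot_hom_lift.
exact/P_objective_ge_opt/P_feasible_lift.
Qed.

(** An optimal S has trace (Z S Z^T) = 0, hence Z S = 0, and the lifted point is
the only normalized symmetric matrix annihilated by Z. *)
Lemma critical_P_optimal : unique (P_optimal f g) (lift_mx y).
Proof.
split=> [|S [feasS minS]].
  split=> [|S feasS]; first exact: P_feasible_lift.
  by rewrite mxdot_hom_lift; apply: P_objective_ge_opt.
have := minS _ (P_feasible_lift y_feasible); rewrite mxdot_hom_lift.
move=> /(le_trans (P_objective_ge feasS)); rewrite gerDl pmulr_rle0 // => trW.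
have [_ E00S psdS] := feasS.
apply/esym/centering_mx_lift_uniq => //; first by case: psdS.
exact: psd_congr_trace0 trW.
Qed.

(** Uniqueness of the nearest point is inherited from the relaxation, as every
nearest point lifts to an optimal solution of (P). *)
Lemma critical_SDP_recovers : SDP_recovers g theta.
Proof.
exists y; split; last exact: critical_P_optimal.
split=> [|z [gz zmin]]; first exact: critical_minimizer.
apply: lift_mx_inj; apply: (proj2 critical_P_optimal).
split; first exact: P_feasible_lift.
move=> S feasS; rewrite mxdot_hom_lift dist_quadE.
apply: le_trans (zmin _ y_feasible) _.
by rewrite -dist_quadE P_objective_ge_opt.
Qed.

Lemma D_feasible_critical : D_feasible f g (- quad_eval f y, mu).
Proof.
rewrite /D_feasible /= addrAC -hom_mx_lagrangian hom_mx_lagrangian_critical.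
rewrite scaleNr addrAC subrr add0r; split.
  by rewrite !trmx_mul trmxK lagrangian_sym mulmxA.
move=> x; rewrite -mxdot_sqr; apply: le_trans (mxdot_remainder_ge (psd_sqr x)).
by apply: mulr_ge0 => //; apply/psd_trace_ge0/psd_congr/psd_sqr.
Qed.

Lemma critical_zero_duality_gap : zero_duality_gap g theta.
Proof.
have npp_val : npp_value g theta = (quad_eval f y)%:E.
  apply/le_anti/andP; split.
    by apply: ereal_inf_lbound; exists y => //; rewrite dist_quadE.
  apply: le_ereal_inf_tmp => _ [z gz <-]; rewrite lee_fin dist_quadE.
  by apply critical_minimizer.
split; rewrite npp_val; apply/le_anti/andP; split.
- apply: le_ereal_inf_tmp => _ [S feasS <-]; rewrite lee_fin.
  exact: P_objective_ge_opt.
- apply: ereal_inf_lbound; exists (lift_mx y); first exact: P_feasible_lift.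
  by rewrite mxdot_hom_lift.
- apply: ereal_sup_ubound; exists (- quad_eval f y, mu); last by rewrite opprK.
  exact: D_feasible_critical.
(* Weak duality only has to be tested against the rank one matrix lifting y. *)
- apply: ge_ereal_sup => _ [[l nu] /= [_ D_ge0] <-]; rewrite lee_fin lerNl.
  have := D_ge0 (row_mx 1%:M y); rewrite -mxdot_sqr -/(lift_mx y).
  rewrite !mxdotDl mxdotZl mxdot_lift_E00 mulr1 mxdot_hom_lift mxdot_suml.
  rewrite big1 ?addr0; first by rewrite -lerBlDl sub0r.
  by move=> i _; rewrite mxdotZl mxdot_hom_lift y_feasible mulr0.
Qed.

End GlobalCertificate.
End Certificate.

(** * Bounds in the sup norm of matrices *)

Section MatrixNorm.
Context {R : realType}.

Lemma ler_mx_entry p k (A : 'M[R]_(p, k)) i j : `|A i j| <= `|A|.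
Proof.
rewrite [leRHS]/Num.Def.normr /= mx_normrE.
exact: (le_bigmax _ _ (i, j)).
Qed.

Lemma mx_norm_leP p k (A : 'M[R]_(p, k)) e : 0 <= e ->
  (forall i j, `|A i j| <= e) -> `|A| <= e.
Proof.
move=> e0 Ae; rewrite /Num.Def.normr /= mx_normrE.
by apply: bigmax_le => // -[].
Qed.

Lemma mulmx_norm_le p k l (A : 'M[R]_(p, k)) (B : 'M[R]_(k, l)) :
  `|A *m B| <= k%:R * (`|A| * `|B|).
Proof.
apply: mx_norm_leP => [|i j]; first by rewrite !mulr_ge0.
rewrite mxE; apply: le_trans (ler_norm_sum _ _ _) _.
have -> (a : R) : k%:R * a = \sum_(s < k) a.
  by rewrite sumr_const card_ord mulr_natl.
by apply: ler_sum => s _; rewrite normrM ler_pM // ler_mx_entry.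
Qed.

Lemma sqnorm_ge_norm n (v : 'rV[R]_n) : `|v| ^+ 2 <= sqnorm v.
Proof.
rewrite -(sqr_sqrtr (a := sqnorm v)); last first.
  by apply: sumr_ge0 => i _; exact: sqr_ge0.
rewrite lerXn2r ?nnegrE ?sqrtr_ge0 //.
apply: mx_norm_leP => [|i j]; first exact: sqrtr_ge0.
rewrite ord1 -sqrtr_sqr ler_wsqrtr // /sqnorm (bigD1 j) //= lerDl.
by apply: sumr_ge0 => k _; exact: sqr_ge0.
Qed.

Lemma sqnorm_le_norm n (v : 'rV[R]_n) : sqnorm v <= n%:R * `|v| ^+ 2.
Proof.
have -> (a : R) : n%:R * a = \sum_(i < n) a.
  by rewrite sumr_const card_ord mulr_natl.
apply: ler_sum => i _.
by rewrite -[leLHS]ger0_norm ?sqr_ge0 // normrX lerXn2r ?nnegrE // ler_mx_entry.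
Qed.

(** Comparison of Euclidean norms transfers to sup norms up to a dimensional
constant; n.+1 is a square-root-free bound for the square root of n. *)
Lemma sqnorm_le_norm_le n (u v : 'rV[R]_n) :
  sqnorm u <= sqnorm v -> `|u| <= n.+1%:R * `|v|.
Proof.
move=> uv; rewrite -(@ler_pXn2r _ 2) ?nnegrE ?mulr_ge0 // exprMn.
apply: le_trans (sqnorm_ge_norm u) _; apply: le_trans uv _.
apply: le_trans (sqnorm_le_norm v) _; apply: ler_wpM2r; first exact: sqr_ge0.
by rewrite -natrX ler_nat; apply: leq_trans (leqnSn n) _; rewrite leq_pmulr.
Qed.

End MatrixNorm.

(** * Derivatives of quadratic polynomials *)

Section QuadCalculus.
Context {R : realType} {n : nat}.
Implicit Types (q : quad R n) (y v : 'rV[R]_n).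

Lemma differentiable_quad_eval q y : differentiable (quad_eval q) y.
Proof.
pose X k : 'rV[R]_n -> R := fun y => y 0 k.
have dX k : differentiable (X k) y by exact: differentiable_coord.
have dcst a : differentiable (cst a : 'rV[R]_n -> R) y.
  exact: differentiable_cst.
have -> : quad_eval q =
    (\sum_j (\sum_k (cst (quad_A q k j) * X k)) * X j)
    + \sum_j (cst (2 * quad_b q 0 j) * X j) + cst (quad_e q).
  apply/funext => z; rewrite /quad_eval !fctE !fct_sumE.
  congr (_ + _ + _).
    rewrite mxE; apply: eq_bigr => j _; rewrite !mxE !fctE fct_sumE.
    congr (_ * _).
    by apply: eq_bigr => k _; rewrite mulrC.
  by rewrite mxE mulr_sumr; apply: eq_bigr => j _; rewrite mxE mulrA.
apply: differentiableD => //; apply: differentiableD.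
  apply: differentiable_sum => j; apply: differentiableM => //.
  by apply: differentiable_sum => k; apply: differentiableM.
by apply: differentiable_sum => j; apply: differentiableM.
Qed.

Lemma derive_quad_eval q y v :
  'D_v (quad_eval q) y = 2 * (quad_grad q y *m v^T) 0 0.
Proof.
apply: cvg_lim => //=.
pose l (h : R) := 2 * (quad_grad q y *m v^T) 0 0
                   + h * (v *m quad_A q *m v^T) 0 0.
have l0 : l h @[h --> 0^'] --> 2 * (quad_grad q y *m v^T) 0 0.
  rewrite -[X in _ --> X]addr0; apply: cvgD; first exact: cvg_cst.
  rewrite -[X in _ --> X](mul0r ((v *m quad_A q *m v^T) 0 0)).
  by apply: cvgM; [exact: nbhs_dnbhs | exact: cvg_cst].
apply: cvg_trans l0; apply: near_eq_cvg; near=> h.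
have h_neq0 : h != 0 by near: h; exact: nbhs_dnbhs_neq.
rewrite /l addrC [h *: v + y]addrC quad_evalD linearZ /=.
rewrite -!scalemxAl -!scalemxAr.
rewrite ![(_ *: _ : 'M_1) 0 0]mxE /GRing.scale /=; by field.
Unshelve. all: by end_near. Qed.

Lemma diff_quad_eval q y v :
  'd (quad_eval q) y v = 2 * (quad_grad q y *m v^T) 0 0.
Proof.
rewrite -deriveE ?derive_quad_eval //.
exact: differentiable_quad_eval.
Qed.

Definition grad_mx m (g : 'I_m -> quad R n) y : 'M[R]_(m, n) :=
  \matrix_i quad_grad (g i) y.

Lemma jacobian_constraint_map m (g : 'I_m -> quad R n) y :
  'J (constraint_map g) y = 2 *: (grad_mx g y)^T.
Proof.
have cmapE : constraint_map g =
    \sum_i (fun z => quad_eval (g i) z *: (delta_mx 0 i : 'rV[R]_m)).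
  apply/funext => z; rewrite fct_sumE; apply/rowP => j; rewrite mxE summxE.
  rewrite (bigD1 j) //= big1 ?addr0 => [|i ij]; rewrite !mxE eqxx /=.
    by rewrite eqxx mulr1.
  by rewrite eq_sym (negPf ij) mulr0.
have cmap_diff : differentiable (constraint_map g) y.
  rewrite cmapE; apply: differentiable_sum => i; apply: differentiableZl.
  exact: differentiable_quad_eval.
apply/row_matrixP => k; rewrite rowE -deriveEjacobian //.
rewrite derive_mx; last exact: diff_derivable.
apply/rowP => i; rewrite !mxE.
under [X in 'D__ X _]eq_fun do rewrite mxE.
rewrite derive_quad_eval trmx_delta -colE !mxE; congr (_ * _).
Qed.

End QuadCalculus.

(** The difference quotients are nonnegative on the right of 0. *)
Lemma diff_ge0_of_min {R : realType} {V : normedModType R} (f : V -> R) z v :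
  differentiable f z -> (\forall h \near (0 : R), f z <= f (h *: v + z)) ->
  0 <= 'd f z v.
Proof.
move=> df fmin; rewrite -deriveE //.
have dfv : derivable f z v by exact: diff_derivable.
rewrite /derive cvg_at_rightE //; apply: limr_ge.
  rewrite -(cvg_at_rightE
    (fun h : R => h^-1 *: ((f \o shift z) (h *: v) - f z))) //.
  apply: cvg_trans dfv; apply: cvg_app.
  move=> A [e egt0 Ae]; exists e => // x xe xgt0; apply: Ae => //.
  exact/lt0r_neq0.
near=> h; apply: mulr_ge0.
  by rewrite invr_ge0; apply: ltW; near: h; exists 1 => /=.
rewrite subr_ge0 /=; near: h.
by case: fmin => e e0 fe; exists e => // x xe _; apply: fe.
Unshelve. all: by end_near. Qed.

Lemma diff_eq0_of_min {R : realType} {V : normedModType R} (f : V -> R) z v :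
  differentiable f z -> (\forall h \near (0 : R), f z <= f (h *: v + z)) ->
  'd f z v = 0.
Proof.
move=> df fmin; apply/le_anti; rewrite diff_ge0_of_min // andbT.
have := @diff_ge0_of_min _ _ f z (- v) df.
rewrite linearN oppr_ge0; apply.
case: fmin => e e0 fe; exists e => // h he.
by rewrite scalerN -scaleNr; apply: fe; rewrite /= sub0r opprK -normrN -sub0r.
Qed.

(** * Nearest points and tangent spaces *)

(** The rows of X span the tangent space of Y at y: they are the images of the
first d basis vectors under the derivative of the inverse chart, which is
invertible.  A function minimal at y along Y pulls back to a function minimal
along these directions; this covers both the distance to theta, minimal at a
nearest point, and the constraints, which are constant along Y. *)
Lemma chart_tangent (R : realType) n (Y : set 'rV[R]_n) (y0 : 'rV[R]_n) d :
  smooth_manifold_near Y y0 d ->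
  \forall y \near y0, Y y -> exists X : 'M[R]_n, \rank X = d /\
    forall f : 'rV[R]_n -> R, differentiable f y ->
      (forall y', Y y' -> f y <= f y') -> forall v, 'd f y (v *m X) = 0.
Proof.
move=> [dn [U [V [phi [psi [[openU openV Uy0] [sphi spsi] phiK psiK YE]]]]]].
have {Uy0} : nbhs y0 U by exact: open_nbhs_nbhs.
apply: filterS => y Uy Yy.
have [Vz psiz] := phiK _ Uy; set z := phi y in Vz psiz.
have dphi : differentiable phi y by have [/(_ _ Uy)] := sphi 1%N.
have dpsi : differentiable psi z by have [/(_ _ Vz)] := spsi 1%N.
have J_inv : 'J phi y *m 'J psi z = 1%:M.
  apply/row_matrixP => i; rewrite row_mul !rowE mulmx1.
  rewrite -!deriveEjacobian // !deriveE //.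
  rewrite -[LHS]/(('d psi z \o 'd phi y) _) -diff_comp //.
  rewrite -deriveE; last exact: differentiable_comp.
  rewrite -[RHS](derive_id y); apply: near_eq_derive.
  by apply: filterS (open_nbhs_nbhs (conj openU Uy)) => x /phiK[].
exists (pid_mx d *m 'J psi z); split=> [|f df fmin v].
  rewrite mxrankMfree ?rank_pid_mx //.
  by rewrite row_free_unit; case/mulmx1_unit: J_inv.
have dfy : differentiable f (psi z) by rewrite psiz.
have := diff_comp dpsi dfy; rewrite psiz => dcomp.
rewrite mulmxA -deriveEjacobian // deriveE //.
rewrite -[LHS]/(('d f y \o 'd psi z) _) -dcomp.
apply: diff_eq0_of_min; first exact: differentiable_comp.
have Vnear : \forall h \near (0 : R), V (h *: (v *m pid_mx d) + z).
  have : (h *: (v *m pid_mx d) + z) @[h --> (0 : R)] -->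
      0 *: (v *m pid_mx d) + z.
    apply: cvgD; last exact: cvg_cst.
    by apply: cvgZ; [exact: cvg_id|exact: cvg_cst].
  by apply; rewrite scale0r add0r; exact: open_nbhs_nbhs.
apply: filterS Vnear => h /psiK[Upsi phipsi] /=.
rewrite psiz; apply: fmin; apply/(YE _ Upsi) => i di.
rewrite phipsi mxE (proj1 (YE _ Uy) Yy i di) addr0 mxE.
rewrite mxE big1 ?mulr0 // => j _; rewrite mxE.
by case: eqP => [->|]; rewrite ?mulr0 //= ltnNge di mulr0.
Qed.

Lemma nearest_point_exists (R : realType) n m (g : 'I_m -> quad R n)
    (theta y0 : 'rV[R]_n) : zero_set g y0 ->
  exists y, npp_minimizer g theta y.
Proof.
move=> Yy0.
have cont q : continuous (quad_eval q : 'rV[R]_n -> R).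
  move=> y; apply: differentiable_continuous.
  exact: differentiable_quad_eval.
pose A := zero_set g `&`
  [set y | quad_eval (dist_quad theta) y <= sqnorm (y0 - theta)].
have A0 : A y0 by split=> //=; rewrite dist_quadE.
have closedA : closed A.
  apply: closedI.
    rewrite [zero_set g](_ : _ = \bigcap_i (quad_eval (g i) @^-1` [set 0])).
      apply: closed_bigI => i _; apply: closed_comp; last exact: closed_eq.
      by move=> y _; exact: cont.
    by apply/seteqP; split=> [y Yy i _|y Yy i]; [exact: Yy|exact: (Yy i)].
  apply: (@closed_comp _ _ (quad_eval (dist_quad theta)) [set t | t <= _]).
    by move=> y _; exact: cont.
  exact: closed_le.
have boundedA : bounded_set A.
  exists (n.+1%:R * `|y0 - theta| + `|theta|); split=> [|M ltM y [_]] /=.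
    exact: num_real.
  rewrite dist_quadE => /sqnorm_le_norm_le yM; rewrite -(subrK theta y).
  apply: le_trans (ler_normD _ _) _; apply: le_trans (ltW ltM).
  by rewrite lerD2r.
have compA := bounded_closed_compact boundedA closedA.
have contA : {within A, continuous (quad_eval (dist_quad theta))}.
  exact/continuous_subspaceT/cont.
have [y /set_mem[Yy yA] ymin] := EVT_min_rV (ex_intro _ _ A0) compA contA.
exists y; split=> // y' Yy'; rewrite -!dist_quadE.
have [y'A|y'A] :=
    leP (quad_eval (dist_quad theta) y') (sqnorm (y0 - theta)).
  by apply: ymin; rewrite inE.
exact: le_trans yA (ltW y'A).
Qed.

(** * Small multipliers near a qualified point *)

(** The quantitative form of the rank argument.  The rows of B are orthogonal to
X and, B L being close to the identity, they are independent; so they form a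
basis of the orthogonal complement of X, in which w lies, and c is controlled by
c B L = w L. *)
Lemma multiplier_bound (R : realType) n r d (B : 'M[R]_(r, n))
    (L : 'M[R]_(n, r)) (X : 'M[R]_n) (w : 'rV[R]_n) :
  \rank X = d -> r = (n - d)%N -> r%:R * `|B *m L - 1%:M| <= 2^-1 ->
  X *m B^T = 0 -> X *m w^T = 0 ->
  exists2 c : 'rV[R]_r, w = c *m B & `|c| <= 2 * (n%:R * (`|w| * `|L|)).
Proof.
move=> rankX rE BL1 XB Xw.
have almost_isometry (c : 'rV[R]_r) : `|c| <= 2 * `|c *m B *m L|.
  have -> : c *m B *m L = c + c *m (B *m L - 1%:M).
    by rewrite mulmxBr mulmx1 mulmxA subrKC.
  have small : `|c *m (B *m L - 1%:M)| <= 2^-1 * `|c|.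
    apply: le_trans (mulmx_norm_le _ _) _; rewrite mulrCA mulrC.
    by apply: ler_wpM2r.
  have := lerB_normD c (c *m (B *m L - 1%:M)); move: small.
  by move=> small tri; lra.
have rankB : \rank B = r.
  apply/eqP; apply/inj_row_free => c cB; apply/eqP; rewrite -normr_le0.
  by have := almost_isometry c; rewrite cB mul0mx normr0 mulr0.
have B_ker : (B <= kermx X^T)%MS.
  by apply/sub_kermxP; rewrite -[LHS]trmxK trmx_mul trmxK XB trmx0.
have w_ker : (w <= kermx X^T)%MS.
  by apply/sub_kermxP; rewrite -[LHS]trmxK trmx_mul trmxK Xw trmx0.
have ker_B : (kermx X^T <= B)%MS.
  by rewrite -(mxrank_leqif_sup B_ker) rankB mxrank_ker mxrank_tr rankX rE.
have /submxP[c wE] := submx_trans w_ker ker_B.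
exists c => //; apply: le_trans (almost_isometry c) _; rewrite -wE.
by apply: ler_wpM2l => //; exact: mulmx_norm_le.
Qed.

Lemma near_mul_norm_lt (R : realType) (V : normedModType R) (x : V) (a b : R) :
  0 <= a -> 0 < b -> \forall y \near x, a * `|y - x| < b.
Proof.
move=> a_ge0 b_gt0; apply/nbhs_normP; exists (b / (a + 1)) => [|y] /=.
  by rewrite divr_gt0 // ltr_wpDl.
rewrite distrC ltr_pdivlMr ?ltr_wpDl //; apply: le_lt_trans.
by rewrite mulrC ler_wpM2l // lerDl.
Qed.

Section NearThetabar.
Context {R : realType} {n m : nat} (g : 'I_m -> quad R n).

Lemma grad_mxB (y y' : 'rV[R]_n) i :
  row i (grad_mx g y - grad_mx g y') = (y - y') *m quad_A (g i).
Proof.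
by rewrite linearB /= !rowK /quad_grad opprD addrACA subrr addr0 mulmxBl.
Qed.

Let C : R := \sum_i `|quad_A (g i)|.

Lemma grad_mx_lipschitz (y y' : 'rV[R]_n) :
  `|grad_mx g y - grad_mx g y'| <= n%:R * C * `|y - y'|.
Proof.
have C_ge0 : 0 <= C by exact: sumr_ge0.
apply: mx_norm_leP => [|i j]; first by rewrite !mulr_ge0.
have -> : (grad_mx g y - grad_mx g y') i j =
    row i (grad_mx g y - grad_mx g y') 0 j by rewrite [RHS]mxE.
rewrite grad_mxB; apply: le_trans (ler_mx_entry _ _ _) _.
apply: le_trans (mulmx_norm_le _ _) _; rewrite -mulrA ler_wpM2l //.
rewrite mulrC ler_wpM2r // /C (bigD1 i) //= lerDl.
exact: sumr_ge0.
Qed.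

Lemma hessian_bound (mu : 'rV[R]_m) :
  `|\sum_i mu 0 i *: quad_A (g i)| <= C * `|mu|.
Proof.
apply: le_trans (ler_norm_sum _ _ _) _; rewrite mulr_suml.
by apply: ler_sum => i _; rewrite normrZ mulrC ler_wpM2l // ler_mx_entry.
Qed.

(** K and L come from a rank factorization of the half-gradient matrix at y0;
K G(y) L stays close to 1 for y near y0 because G is affine in y. *)
Lemma multiplier_near (y0 : 'rV[R]_n) : ACQ g y0 ->
  exists2 D : R, 0 <= D &
  \forall y \near y0, forall theta, npp_minimizer g theta y ->
  exists2 mu : 'rV[R]_m,
    y - theta + \sum_i mu 0 i *: quad_grad (g i) y = 0 &
    `|\sum_i mu 0 i *: quad_A (g i)| <= D * `|y - theta|.
Proof.
move=> [d [mfd rankJ]]; set G0 := grad_mx g y0.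
have rankG0 : \rank G0 = (n - d)%N.
  by rewrite -rankJ jacobian_constraint_map eqmx_scale ?mxrank_tr // pnatr_eq0.
pose r := \rank G0.
pose K : 'M[R]_(r, m) := pinvmx (col_base G0).
pose L : 'M[R]_(n, r) := pinvmx (row_base G0).
have KG0L : K *m G0 *m L = 1%:M.
  have -> : K *m G0 = row_base G0.
    by rewrite -[G0 in LHS]mulmx_base mulmxA /K mulVpmx ?col_base_full ?mul1mx.
  by rewrite mulmxVp ?row_base_free.
pose D1 := C * (r%:R * (2 * (n%:R * `|L|) * `|K|)).
have C_ge0 : 0 <= C by exact: sumr_ge0.
exists D1; first by rewrite !mulr_ge0.
pose D2 : R := r%:R * (n%:R * (m%:R * (`|K| * (n%:R * C)) * `|L|)).
have D2_ge0 : 0 <= D2 by rewrite !mulr_ge0.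
have near_y0 : \forall y \near y0, D2 * `|y - y0| < 2^-1.
  by apply: near_mul_norm_lt => //; rewrite invr_gt0.
near=> y => theta ymin.
have Yy : zero_set g y by case: ymin.
have [X [rankX Xtangent]] : exists X : 'M[R]_n, \rank X = d /\
    forall f : 'rV[R]_n -> R, differentiable f y ->
      (forall y', zero_set g y' -> f y <= f y') ->
      forall v, 'd f y (v *m X) = 0.
  by move: Yy; near: y; exact: chart_tangent.
have Xgrad q : (forall y', zero_set g y' -> quad_eval q y <= quad_eval q y') ->
    X *m (quad_grad q y)^T = 0.
  move=> qmin; apply/row_matrixP => i; rewrite row_mul row0.
  apply/rowP => j; rewrite ord1 [RHS]mxE.
  have := Xtangent _ (differentiable_quad_eval q y) qmin (delta_mx 0 i).
  rewrite diff_quad_eval -rowE => /eqP.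
  rewrite mulf_eq0 pnatr_eq0 /= => /eqP e0.
  by rewrite -[row i X *m _]trmxK trmx_mul trmxK mxE.
have XG : X *m (grad_mx g y)^T = 0.
  apply/trmx_inj; rewrite trmx_mul trmxK trmx0; apply/row_matrixP => i.
  rewrite row_mul rowK row0; apply/trmx_inj.
  rewrite trmx_mul trmxK trmx0; apply: Xgrad => y' Yy'.
  by rewrite Yy Yy'.
have Xw : X *m (y - theta)^T = 0.
  rewrite -quad_grad_dist; apply: Xgrad => y' Yy'.
  by rewrite !dist_quadE; case: ymin => _; apply.
have small : r%:R * `|K *m grad_mx g y *m L - 1%:M| <= 2^-1.
  have : D2 * `|y - y0| < 2^-1 by near: y.
  move=> /ltW; apply: le_trans.
  rewrite -KG0L -mulmxBl -mulmxBr /D2 -!mulrA ler_wpM2l //.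
  apply: le_trans (mulmx_norm_le _ _) _; rewrite ler_wpM2l //.
  rewrite [X in _ <= X](_ : _ =
    (m%:R * (`|K| * (n%:R * C * `|y - y0|))) * `|L|); last by ring.
  rewrite ler_wpM2r //; apply: le_trans (mulmx_norm_le _ _) _.
  by rewrite !ler_wpM2l //; exact: grad_mx_lipschitz.
have [] := multiplier_bound (w := y - theta) rankX rankG0 small _ Xw.
  by rewrite trmx_mul mulmxA XG mul0mx.
move=> c wE c_le; exists (- (c *m K)).
  rewrite {1}wE mulmxA mulmx_sum_row -big_split big1 // => i _.
  by rewrite /= [(- (c *m K)) 0 i]mxE scaleNr rowK subrr.
apply: le_trans (hessian_bound _) _; rewrite normrN /D1 -mulrA.
apply: ler_wpM2l => //.
apply: le_trans (mulmx_norm_le _ _) _; rewrite -[leRHS]mulrA.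
apply: ler_wpM2l => //; rewrite mulrAC; apply: ler_wpM2r => //.
by apply: le_trans c_le _; rewrite -!mulrA [`|L| * _]mulrC.
Unshelve. all: by end_near. Qed.

Lemma critical_pair_near (y0 : 'rV[R]_n) : zero_set g y0 -> ACQ g y0 ->
  \forall theta \near y0, exists y (mu : 'I_m -> R),
    [/\ zero_set g y, y - theta + \sum_i mu i *: quad_grad (g i) y = 0
      & exists2 e : R, e * n%:R <= 2^-1 &
        forall j k, `|(\sum_i mu i *: quad_A (g i)) j k| <= e].
Proof.
move=> Yy0 /multiplier_near[D D_ge0 /nbhs_normP[e /= e_gt0 De]].
have near_e : \forall theta \near y0, n.+2%:R * `|theta - y0| < e.
  exact: near_mul_norm_lt.
have near_D : \forall theta \near y0,
    D * n.+1%:R * `|theta - y0| < 2^-1 / n.+1%:R.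
  by apply: near_mul_norm_lt; rewrite ?mulr_ge0 ?divr_gt0.
(* |y - theta| <= n.+1 |theta - y0| gives |y - y0| <= n.+2 |theta - y0|. *)
near=> theta.
have [y ymin] := nearest_point_exists theta Yy0; have [Yy y_le] := ymin.
have w_le : `|y - theta| <= n.+1%:R * `|theta - y0|.
  by rewrite (distrC theta); apply/sqnorm_le_norm_le/y_le.
have ye : ball_ Num.norm y0 e y.
  have : (n.+2%:R : R) * `|theta - y0| < e by near: theta.
  apply: le_lt_trans; rewrite distrC -(subrKA theta).
  apply: le_trans (ler_normD _ _) _.
  by rewrite -natr1 mulrDl mul1r lerD2r.
have [mu crit mu_le] := De _ ye _ ymin.
exists y, (mu 0); split=> //; exists (2^-1 / n.+1%:R).
  by rewrite mulrAC ler_pdivrMr // ler_wpM2l // ler_nat.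
move=> j k; apply: le_trans (ler_mx_entry _ _ _) _; apply: le_trans mu_le _.
apply: le_trans (ler_wpM2l D_ge0 w_le) _; rewrite mulrA; apply: ltW.
by near: theta.
Unshelve. all: by end_near. Qed.

End NearThetabar.

Theorem corollary3p10 (R : realType) (n m : nat) (g : 'I_m -> quad R n)
    (thetabar : 'rV[R]_n)
    (hY : zero_set g thetabar)
    (hACQ : ACQ g thetabar) :
  SDP_stable_near g thetabar /\
  (\forall theta \near thetabar, SDP_recovers g theta).
Proof.
have crit := critical_pair_near hY hACQ.
split; apply: filterS crit => theta [y [mu [Yy ycrit mu_small]]].
  exact: critical_zero_duality_gap ycrit mu_small.
exact: critical_SDP_recovers ycrit mu_small.
Qed.
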